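(* Let $s,t\geq 1$ be integers and let $p,q,l$ be three distinct primes with $p,q$ odd, $p\equiv 3 \pmod 4$, $\mathrm{ord}_{p^s}(l)=\phi(p^s)/2$, $\mathrm{ord}_{q^t}(l)=\phi(q^t)$ and $\gcd(\phi(p^s),\phi(q^t))=2$. Let $0\leq i\leq s-1$. Then in the ring $\mathbb{F}_l[x]/\langle x^{p^sq^t}-1\rangle$: (i) $\chi_{it}^2=\frac{p-3}{4}p^{s-i-1}\chi_{it}+\frac{p+1}{4}p^{s-i-1}\chi_{it}^*$. (ii) $(\chi_{it}^* )^2=\frac{p-3}{4}p^{s-i-1}\chi_{it}^*+\frac{p+1}{4}p^{s-i-1}\chi_{it}$. (iii) $\chi_{it}\chi_{it}^*=\frac{p-3}{4}p^{s-i-1}(\chi_{it}+\chi_{it}^* )+\frac{\phi(p^{s-i})}{2}\Big(\sum_{i<k\leq s-1}(\chi_{kt}+\chi_{kt}^* )+1\Big)$.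
   Context: Here $\phi$ is Euler's phi function (with $\phi(1)=1$) and $\mathrm{ord}_m(k)$ is the multiplicative order of $k$ modulo $m$. Put $n=p^sq^t$. Fix an integer $g$ that is a primitive root both modulo $p^s$ and modulo $q^t$. For an integer $\gamma$, $C_\gamma=\{\gamma l^r \bmod n: r\geq 0\}\subseteq \mathbb{Z}_n$ is the $l$-cyclotomic coset modulo $n$ containing $\gamma$. For $0\leq i\leq s$, $0\leq j\leq t$ set $C_{ij}=C_{p^iq^j}$ and $C_{ij}^*=C_{p^iq^jg}$; in particular $C_{sj}=C_{sj}^*$ and $C_{st}=C_0=\{0\}$. Define elements of $\mathbb{F}_l[x]/\langle x^{n}-1\rangle$ by $\chi_{ij}=\sum_{\alpha\in C_{ij}}x^\alpha$ and $\chi_{ij}^*=\sum_{\alpha\in C_{ij}^*}x^\alpha$; in particular $\chi_{sj}=\chi_{sj}^*$ and $\chi_{st}=1$. Integer coefficients are read in $\mathbb{F}_l$, and empty sums are $0$. *)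

(* Defs.v *)
From HB Require Import structures.
From mathcomp Require Import all_boot all_order all_algebra all_fingroup.
Set Implicit Arguments.
Unset Strict Implicit.
Unset Printing Implicit Defensive.
Import Order.TTheory GRing.Theory Num.Theory.
Local Open Scope ring_scope.

(* The order of k in the group of units modulo m, for m > 1; the value is 0
   when k is not a unit modulo m. *)
Definition mult_order (m : nat) (k : int) : nat :=
  if insub (k%:~R : 'Z_m) is Some u then #[u : {unit 'Z_m}]%g else 0%N.

Definition primitive_root_mod (m : nat) (g : int) : bool :=
  mult_order m g == totient m.

(* {gamma * l ^ r mod n : r >= 0}, for n > 1, as an orbit of multiplication
   by l on 'Z_n; see cyclotomic_cosetP. *)
Definition cyclotomic_coset (n l : nat) (gamma : int) : {set 'Z_n} :=
  [set a | fconnect (fun x : 'Z_n => x * l%:R) gamma%:~R a].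

Lemma cyclotomic_cosetP (n l : nat) (gamma : int) (a : 'Z_n) :
  reflect (exists r : nat, a = (gamma * l%:Z ^+ r)%:~R)
          (a \in cyclotomic_coset n l gamma).
Proof.
have iterE r : iter r (fun x : 'Z_n => x * l%:R) gamma%:~R
               = (gamma * l%:Z ^+ r)%:~R.
  elim: r => [|r IHr] /=; first by rewrite expr0 mulr1.
  by rewrite IHr exprSr mulrA [in RHS]intrM.
rewrite inE; apply: (iffP idP) => [ga | [r ->]].
  by exists (findex (fun x : 'Z_n => x * l%:R) gamma%:~R a);
     rewrite -iterE iter_findex.
by rewrite -iterE fconnect_iter.
Qed.

Notation cyclic_ring l n := {poly %/ ('X^n - 1 : {poly 'F_l})}.

(* {poly %/ h} is the quotient by mk_monic h. *)
Lemma cyclic_ring_modulus (l n : nat) :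
  (0 < n)%N -> mk_monic ('X^n - 1 : {poly 'F_l}) = 'X^n - 1.
Proof.
move=> n_gt0; rewrite /mk_monic size_XnsubC // ltnS n_gt0 /=.
by rewrite monicXnsubC.
Qed.

Definition coset_sum (n l : nat) (gamma : int) : cyclic_ring l n :=
  \sum_(a in cyclotomic_coset n l gamma)
     ('qX : cyclic_ring l n) ^+ (a : nat).

Definition chi (p q s t l i j : nat) : cyclic_ring l (p ^ s * q ^ t) :=
  coset_sum (p ^ s * q ^ t) l (p ^ i * q ^ j)%N%:Z.

Definition chi_star (p q s t l : nat) (g : int) (i j : nat) :
    cyclic_ring l (p ^ s * q ^ t) :=
  coset_sum (p ^ s * q ^ t) l ((p ^ i * q ^ j)%N%:Z * g).

(* Main.v *)
(* Multiplication by p^i q^t identifies Z/p^(s-i) with a subgroup of Z/n; under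
   it, C_it and C_it^* become, in R = Z/p^(s-i), the sets H = {a : a^h = 1} and
   -H = {a : a^h = -1}, where h = phi(p^s)/2. Since p = 3 mod 4, h is odd, so
   -1 is not in H, and R is the disjoint union of H, -H and its set J of
   nonunits, with H + J = H. Multiplying the sums over H and -H amounts to
   counting the solutions of a + b = c in H or -H. The counts depend only on
   the class of c: for a, b in H they are some alpha on H, beta on -H and 0 on
   J; for a in H, b in -H they are alpha on both H and -H (compare
   a - b = 1 with its inverted form) and |H| on J. Counting all pairs gives
   |H| = 2 alpha + |J| = alpha + beta, which determines alpha and beta. *)
Require Import Defs.
From HB Require Import structures.
From mathcomp Require Import all_boot all_order all_algebra all_fingroup.
From mathcomp Require Import cyclic.
Set Implicit Arguments.
Unset Strict Implicit.
Unset Printing Implicit Defensive.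
Import Order.TTheory GRing.Theory Num.Theory.
Local Open Scope ring_scope.

(** * Rings whose units satisfy a^h = 1 or a^h = -1 with h odd *)

Section HalfSystem.

Variables (R : finComUnitRingType) (h : nat).
Hypotheses (h_odd : odd h) (unit2 : (2%:R : R) \is a GRing.unit).
Hypothesis unit_pm1 :
  forall a : R, a \is a GRing.unit -> a ^+ h = 1 \/ a ^+ h = -1.
Hypothesis nonunitD : forall a b : R,
  a \isn't a GRing.unit -> b \isn't a GRing.unit -> a + b \isn't a GRing.unit.

Definition pos_set : {set R} := [set a | a ^+ h == 1].
Definition neg_set : {set R} := [set a | a ^+ h == -1].
Definition nonunit_set : {set R} := [set a | a \isn't a GRing.unit].

Local Notation H := pos_set.
Local Notation N := neg_set.
Local Notation J := nonunit_set.

Lemma exprN_odd (a : R) : (- a) ^+ h = - a ^+ h.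
Proof. by rewrite exprNn -signr_odd h_odd expr1 mulN1r. Qed.

Lemma opp_pos (a : R) : (- a \in H) = (a \in N).
Proof. by rewrite !inE exprN_odd eqr_oppLR. Qed.

Lemma opp_neg (a : R) : (- a \in N) = (a \in H).
Proof. by rewrite -opp_pos opprK. Qed.

Lemma pos1 : 1 \in H.
Proof. by rewrite inE expr1n. Qed.

Lemma posM (a b : R) : a \in H -> (a * b \in H) = (b \in H).
Proof. by rewrite !inE exprMn => /eqP ->; rewrite mul1r. Qed.

Lemma negM (a b : R) : a \in H -> (a * b \in N) = (b \in N).
Proof. by rewrite !inE exprMn => /eqP ->; rewrite mul1r. Qed.

Lemma pos_unit (a : R) : a \in H -> a \is a GRing.unit.
Proof.
rewrite inE => /eqP ah; rewrite -(unitrX_pos a (odd_gt0 h_odd)) ah.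
exact: unitr1.
Qed.

Lemma neg_unit (a : R) : a \in N -> a \is a GRing.unit.
Proof. by rewrite -opp_pos => /pos_unit; rewrite unitrN. Qed.

Lemma posV (a : R) : a \in H -> a^-1 \in H.
Proof. by move=> aH; rewrite -(posM _ aH) divrr ?pos1 ?pos_unit. Qed.

Lemma pos_neg_disjoint (a : R) : a \in H -> a \in N -> False.
Proof.
rewrite !inE => /eqP-> /eqP E.
have : (2%:R : R) = 0 by rewrite mulr2n {2}E subrr.
by move=> E2; move: unit2; rewrite E2 unitr0.
Qed.

Lemma nonunitN (a : R) : (- a \in J) = (a \in J).
Proof. by rewrite !inE unitrN. Qed.

(* For odd h, a + b divides a ^ h + b ^ h = 2, so it is a unit. *)
Lemma pos_addN_nonunit (a b : R) : a \in H -> b \in H -> a + b \in J -> False.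
Proof.
rewrite !inE => /eqP aH /eqP bH /negP[].
have := subrXX a (- b) h.
rewrite exprN_odd aH bH opprK -mulr2n => E; move: unit2.
by rewrite E opprK unitrM => /andP[].
Qed.

(** For b in H and d in J, b + d is a unit, since nonunits are closed under addition. If it were in
    -H, then b and -(b + d) would be two elements of H with the nonunit sum -d. *)
Lemma pos_addr_nonunit (a c : R) : c \in J -> (a + c \in H) = (a \in H).
Proof.
suff imp (b d : R) : d \in J -> b \in H -> b + d \in H.
  move=> cJ; apply/idP/idP => [|/(imp _ _ cJ)//].
  by move/(imp _ (- c)); rewrite addrK; apply; rewrite nonunitN.
move=> dJ bH.
have bdU : b + d \is a GRing.unit.
  apply: contraLR (pos_unit bH) => bdJ.
  by rewrite -[b](addrK d) nonunitD // -/(- d) unitrN; move: dJ; rewrite inE.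
case: (unit_pm1 bdU) => /eqP E; first by rewrite inE.
have bdN : - (b + d) \in H by rewrite opp_pos inE.
by case: (pos_addN_nonunit bH bdN); rewrite opprD addNKr nonunitN.
Qed.

(** * Counting the solutions of a + b = c *)

(** A solution of a + b = c with a in B and b in C is recorded by a alone. *)
Definition repr_set (B C : {set R}) (c : R) := [set a in B | c - a \in C].
Definition repr_count (B C : {set R}) (c : R) : nat := #|repr_set B C c|.

Lemma in_repr (B C : {set R}) (c a : R) :
  (a \in repr_set B C c) = (a \in B) && (c - a \in C).
Proof. by rewrite inE. Qed.

Lemma eq_repr_count (f : R -> R) (B C B' C' : {set R}) (c c' : R) :
    bijective f ->
    (forall a,
       (f a \in B) && (c - f a \in C) = (a \in B') && (c' - a \in C')) ->
  repr_count B C c = repr_count B' C' c'.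
Proof.
move=> [g fK gK] E; rewrite /repr_count -[RHS](card_imset _ (can_inj fK)).
congr #|pred_of_set _|; apply/setP => a.
by rewrite -[a]gK in_repr E -in_repr mem_imset //; apply: can_inj fK.
Qed.

(** The equation a + b = c is homogeneous, so scaling it by u permutes the solutions. This is why
    the counts depend only on the class of c. *)
Lemma repr_count_scale (B C : {set R}) (u c : R) :
    u \is a GRing.unit ->
    (forall a, (u * a \in B) = (a \in B)) ->
    (forall a, (u * a \in C) = (a \in C)) ->
  repr_count B C (u * c) = repr_count B C c.
Proof.
move=> uU uB uC; apply: (@eq_repr_count ( *%R u)).
  by exists ( *%R u^-1); [apply: mulKr | apply: mulVKr].
by move=> a; rewrite -mulrBr uB uC.
Qed.

Local Notation alpha := (repr_count H H 1).
Local Notation beta := (repr_count H H (-1)).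

Lemma repr_count_pos_pos (c : R) : c \in H -> repr_count H H c = alpha.
Proof.
move=> cH; rewrite -[c]mulr1; apply: repr_count_scale => [|a|a].
- exact: pos_unit.
- exact: posM.
- exact: posM.
Qed.

Lemma repr_count_pos_neg (c : R) : c \in N -> repr_count H H c = beta.
Proof.
rewrite -opp_pos => cH; rewrite -[c]opprK -(mulrN1 (- c)).
by apply: repr_count_scale => [|a|a]; rewrite ?posM ?pos_unit.
Qed.

Lemma repr_count_pos_nonunit (c : R) : c \in J -> repr_count H H c = 0%N.
Proof.
move=> cJ; apply/eqP; rewrite cards_eq0; apply/eqP/setP => a.
rewrite in_repr in_set0; apply/negbTE/negP => /andP[aH caH].
by apply: (pos_addN_nonunit aH caH); rewrite addrC subrK.
Qed.

(* Inversion turns the solutions of a - 1 = b into those of 1 - a = b. *)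
Lemma repr_count_mixed1 : repr_count H N 1 = alpha.
Proof.
apply: (@eq_repr_count GRing.inv) => [|a].
  by exists GRing.inv; apply: invrK.
have [aH|aH] := boolP (a \in H); last first.
  by apply/negbTE/nandP; left; apply: contra aH => /posV; rewrite invrK.
rewrite posV //= -(negM _ aH) mulrBr mulr1 divrr ?pos_unit //.
by rewrite -opp_pos opprB.
Qed.

(** With a - 1 as the unknown, the conditions become a - 1 in H and -a in -H; these are the
    conditions for c = 1 with their order exchanged. *)
Lemma repr_count_mixedN1 : repr_count H N (-1) = alpha.
Proof.
rewrite -repr_count_mixed1.
apply: (@eq_repr_count (fun a : R => a - 1)) => [|a].
  by exists (fun a : R => a + 1) => a; rewrite ?subrK ?addrK.
by rewrite opprB addKr -!opp_pos opprK opprB andbC.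
Qed.

Lemma repr_count_mixed_unit (c : R) :
  c \is a GRing.unit -> repr_count H N c = alpha.
Proof.
case/unit_pm1 => /eqP E.
  have cH : c \in H by rewrite inE.
  rewrite -repr_count_mixed1 -{1}[c]mulr1.
  by apply: repr_count_scale => [|a|a]; rewrite ?posM ?negM ?pos_unit.
have cH : - c \in H by rewrite opp_pos inE.
rewrite -repr_count_mixedN1 -{1}[c]opprK -(mulrN1 (- c)).
by apply: repr_count_scale => [|a|a]; rewrite ?posM ?negM ?pos_unit.
Qed.

(** Here c - a lies in -H iff a - c lies in H, which holds for every a in H because c is a
    nonunit. *)
Lemma repr_count_mixed_nonunit (c : R) : c \in J -> repr_count H N c = #|H|.
Proof.
move=> cJ; apply: eq_card => a; rewrite in_repr -opp_pos opprB.
by rewrite pos_addr_nonunit ?nonunitN // andbb.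
Qed.

Lemma sum_split (V : nmodType) (F : R -> V) :
  \sum_c F c
    = \sum_(c in H) F c + \sum_(c in N) F c + \sum_(c in J) F c.
Proof.
rewrite (bigID [in J]) /= addrC; congr (_ + _).
rewrite (bigID [in H]) /=; congr (_ + _); apply: eq_bigl => c.
  by apply: andb_idl => /pos_unit cU; rewrite inE negbK.
rewrite [c \in J]inE negbK; apply/andP/idP => [[/unit_pm1[] /eqP E]|cN].
- by rewrite inE E.
- by move=> _; rewrite inE.
split; first exact: neg_unit.
by apply/negP => cH; apply: (pos_neg_disjoint cH).
Qed.

(** * Products of sums of a map that turns addition into multiplication *)

Section Sums.

Variables (A : comNzRingType) (e : R -> A).
Hypothesis eD : forall a b : R, e (a + b) = e a * e b.

Local Notation S B := (\sum_(a in B) e a).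

Lemma mul_sums (B C : {set R}) : S B * S C = \sum_c e c *+ repr_count B C c.
Proof.
rewrite big_distrlr /=.
transitivity (\sum_(a in B) \sum_(c | c - a \in C) e c).
  apply: eq_bigr => a _; rewrite [LHS](reindex_inj (addIr (- a))) /=.
  by apply: eq_bigr => c _; rewrite -eD addrC subrK.
rewrite (exchange_big_dep xpredT) //=; apply: eq_bigr => c _.
by rewrite sumr_const; congr (_ *+ _); apply: eq_card => a; rewrite in_repr.
Qed.

Lemma sum_posX2 : S H ^+ 2 = S H *+ alpha + S N *+ beta.
Proof.
rewrite expr2 mul_sums sum_split [X in _ + X]big1 ?addr0.
  rewrite -!sumrMnl; congr (_ + _); apply: eq_bigr => c cP.
    by rewrite repr_count_pos_pos.
  by rewrite repr_count_pos_neg.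
by move=> c cJ; rewrite repr_count_pos_nonunit.
Qed.

Lemma sum_pos_neg : S H * S N = (S H + S N) *+ alpha + S J *+ #|H|.
Proof.
rewrite mul_sums sum_split mulrnDl -!sumrMnl.
congr (_ + _ + _); apply: eq_bigr => c cP.
- by rewrite repr_count_mixed_unit ?pos_unit.
- by rewrite repr_count_mixed_unit ?neg_unit.
- by rewrite repr_count_mixed_nonunit.
Qed.

Lemma sum_negE : S N = \sum_(a in H) e (- a).
Proof.
by rewrite (reindex_inj oppr_inj); apply: eq_bigl => a; rewrite opp_neg.
Qed.

End Sums.

Lemma card_neg : #|N| = #|H|.
Proof.
rewrite -[RHS](card_imset _ oppr_inj); apply: eq_card => a.
by rewrite -[a]opprK (mem_imset _ _ oppr_inj) opp_neg.
Qed.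

Lemma card_ring_split : #|R| = (#|H|.*2 + #|J|)%N.
Proof.
have := sum_split (fun=> 1%N); rewrite !sum1_card => ->.
by rewrite card_neg -addnn.
Qed.

(** Both product formulas are applied to the constant map e = 1 into the integers, which counts all
    pairs; the common factor |H| is then cancelled, H being nonempty. *)
Lemma card_pos_split : #|H| = (alpha.*2 + #|J|)%N /\ #|H| = (alpha + beta)%N.
Proof.
have H0 : (0 < #|H|)%N by apply/card_gt0P; exists 1; apply: pos1.
have eD (a b : R) : 1 = 1 * 1 :> int by rewrite mulr1.
have := sum_pos_neg eD; have := sum_posX2 eD.
rewrite !sumr_const card_neg expr2 -!natrM -!mulrnDr -!mulrnA -!mulrnDr.
move=> /eqP; rewrite eqr_nat eqn_pmul2l // => /eqP E1 /eqP.
rewrite eqr_nat addnn -doubleMl [(#|J| * _)%N]mulnC doubleMr -mulnDr.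
by rewrite eqn_pmul2l // => /eqP.
Qed.

(** The map sending a to e (- a) is again multiplicative and exchanges the sums over H and -H, so
    [sum_posX2] applies to it. *)
Lemma sum_negX2 (A : comNzRingType) (e : R -> A)
    (eD : forall a b : R, e (a + b) = e a * e b) :
  (\sum_(a in N) e a) ^+ 2
    = (\sum_(a in N) e a) *+ alpha + (\sum_(a in H) e a) *+ beta.
Proof.
have e'D (a b : R) : e (- (a + b)) = e (- a) * e (- b) by rewrite opprD eD.
have := sum_posX2 e'D; rewrite -sum_negE => ->; congr (_ + _ *+ _).
by rewrite (reindex_inj oppr_inj); apply: eq_big => a; rewrite ?opp_neg ?opprK.
Qed.

End HalfSystem.

(** * Residues of integers and multiplicative orders *)

Lemma intr_Zp_eq0 (n : nat) (z : int) :
  (1 < n)%N -> ((z%:~R : 'Z_n) == 0) = (n %| z)%Z.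
Proof.
move=> n_gt1.
have natE k : ((k%:R : 'Z_n) == 0) = (n %| k)%N.
  by rewrite -val_eqE /= val_Zp_nat // -/(dvdn n k).
by case: z => k; rewrite ?NegzE ?mulrNz ?oppr_eq0 -pmulrn natE dvdzE.
Qed.

Lemma intr_Zp_dvd (d n : nat) (x y : int) :
    (1 < d)%N -> (0 < n)%N -> (d %| n)%N ->
  x%:~R = y%:~R :> 'Z_n -> x%:~R = y%:~R :> 'Z_d.
Proof.
move=> d_gt1 n_gt0 d_n /eqP; have n_gt1 := leq_trans d_gt1 (dvdn_leq n_gt0 d_n).
rewrite -subr_eq0 -intrB intr_Zp_eq0 // => n_xy.
apply/eqP; rewrite -subr_eq0 -intrB intr_Zp_eq0 //.
exact: dvdz_trans n_xy.
Qed.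

(** Positivity excludes the default value 0 that [mult_order] takes on nonunits. *)
Lemma mult_order_unit (n : nat) (k : int) : (0 < mult_order n k)%N ->
  exists2 u : {unit 'Z_n}, val u = k%:~R & #[u]%g = mult_order n k.
Proof. by rewrite /mult_order; case: insubP => // u _ uE _; exists u. Qed.

Lemma val_expgu (R : finUnitRingType) (u : {unit R}) r :
  val (u ^+ r)%g = val u ^+ r.
Proof. by elim: r => // r IHr; rewrite expgS exprS /= IHr. Qed.

(* An element of odd order cannot generate -1, so l and -1 generate all units as
   soon as l has index 2. *)
Lemma half_order_units (n h : nat) (l : int) :
    (2 < n)%N -> odd h -> totient n = h.*2 -> mult_order n l = h ->
  forall a : 'Z_n, a \is a GRing.unit ->
    exists r, a = l%:~R ^+ r \/ a = - l%:~R ^+ r.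
Proof.
move=> n_gt2 h_odd nE lE a aU.
have n_gt0 : (0 < n)%N by apply: ltn_trans n_gt2.
have [|u uE] := @mult_order_unit n l; first by rewrite lE odd_gt0.
rewrite lE => ou; have v_unit : (-1 : 'Z_n) \is a GRing.unit by rewrite unitrN1.
set v : {unit 'Z_n} := Sub (-1) v_unit.
(* Every element of the group generated by u has h-th power 1, whereas (-1)^h = -1, which differs
   from 1 because n > 2. *)
have vu : v \notin <[u]>%g.
  apply/negP => /cycleP[r vE].
  have : val (v ^+ h)%g = 1 by rewrite vE expgAC -ou expg_order expg1n.
  rewrite val_expgu /= -signr_odd h_odd expr1 => /eqP.
  rewrite -subr_eq0 -opprD oppr_eq0 -[1 + 1]/(2%:~R) intr_Zp_eq0 1?ltnW //.
  by rewrite dvdzE /= gtnNdvd.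
(* The subgroup and its coset by -1 are disjoint and have h elements each, which exhausts the 2h
   units. *)
have cover : (<[u]> :|: v *: <[u]>)%g = [set: {unit 'Z_n}].
  apply/eqP; rewrite eqEcard subsetT /= cardsU card_lcoset -orderE ou.
  rewrite (_ : (_ :&: _)%g = set0) ?cards0 ?subn0.
    by rewrite card_units_Zp // nE addnn.
  apply/setP => x; rewrite !inE; apply/negP => /andP[xu].
  by rewrite mem_lcoset groupMr // groupV (negPf vu).
have : Sub a aU \in (<[u]> :|: v *: <[u]>)%g by rewrite cover inE.
rewrite inE => /orP[/cycleP[r]|/lcosetP[_ /cycleP[r ->]]] /(congr1 val) /= aE.
  by exists r; left; rewrite aE val_expgu uE.
by exists r; right; rewrite aE val_expgu uE mulN1r.
Qed.

Lemma mult_order_expr (n : nat) (k : int) : (0 < mult_order n k)%N ->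
  (k%:~R : 'Z_n) ^+ mult_order n k = 1.
Proof.
by move/mult_order_unit => [u uE <-]; rewrite -uE -val_expgu expg_order.
Qed.

Lemma mult_order_dvd (n : nat) (k : int) r : (0 < mult_order n k)%N ->
  (k%:~R : 'Z_n) ^+ r = 1 -> (mult_order n k %| r)%N.
Proof.
move/mult_order_unit => [u uE <-]; rewrite -uE -val_expgu => ur.
by rewrite order_dvdn; apply/eqP/val_inj.
Qed.

(** * Cyclotomic cosets modulo p^m for m at most s *)

Section PrimePower.

Variables (p s h : nat) (l : nat) (g : int).
Hypotheses (p_prime : prime p) (p_odd : odd p) (s_gt0 : (0 < s)%N).
Hypotheses (h_odd : odd h) (hE : totient (p ^ s) = h.*2).
Hypotheses (ord_l : mult_order (p ^ s) l%:Z = h).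
Hypothesis (ord_g : primitive_root_mod (p ^ s) g).

Lemma odd_prime_expn_gt2 m : (0 < m)%N -> (2 < p ^ m)%N.
Proof.
move=> m_gt0; have p_gt2 : (2 < p)%N by apply: odd_prime_gt2.
by apply: (leq_trans p_gt2); rewrite -{1}[p]expn1 leq_exp2l // ltnW.
Qed.

(** A power of l has h-th power 1, but g has order 2h; only the opposite of a power of l is left. *)
Lemma primitive_root_opp : exists r, (g%:~R : 'Z_(p ^ s)) = - l%:~R ^+ r.
Proof.
have h_gt0 := odd_gt0 h_odd.
have og : mult_order (p ^ s) g = h.*2 by rewrite (eqP ord_g).
have [|u uE _] := @mult_order_unit (p ^ s) g; first by rewrite og double_gt0.
have gU : (g%:~R : 'Z_(p ^ s)) \is a GRing.unit by rewrite -uE (valP u).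
have ps_gt2 := odd_prime_expn_gt2 s_gt0.
have [r [gE|gE]] := half_order_units ps_gt2 h_odd hE ord_l gU;
  last by exists r.
have /mult_order_dvd : (g%:~R : 'Z_(p ^ s)) ^+ h = 1.
  by rewrite gE exprAC -{1}ord_l mult_order_expr ?ord_l // expr1n.
rewrite og double_gt0 => /(_ h_gt0) /(dvdn_leq h_gt0).
by rewrite -addnn -{3}[h]addn0 leq_add2l leqNgt h_gt0.
Qed.

Section Reduction.

Variable m : nat.
Hypotheses (m_gt0 : (0 < m)%N) (m_s : (m <= s)%N).

Local Notation Zm := ('Z_(p ^ m)).

Lemma Zm_reduce (x y : int) :
  x%:~R = y%:~R :> 'Z_(p ^ s) -> x%:~R = y%:~R :> Zm.
Proof.
apply: intr_Zp_dvd; rewrite ?expn_gt0 ?prime_gt0 ?dvdn_exp2l //.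
by rewrite ltnW ?odd_prime_expn_gt2.
Qed.

(** The order of l modulo p^m may be smaller than h, but the relation survives reduction from p^s,
    so a single odd exponent h serves every m. *)
Lemma Zm_expr : (l%:~R : Zm) ^+ h = 1.
Proof.
rewrite -rmorphXn; apply: (@Zm_reduce _ 1).
by rewrite rmorphXn -[X in _ ^+ X]ord_l mult_order_expr // ord_l odd_gt0.
Qed.

Lemma Zm_unit (a : nat) : ((a%:R : Zm) \is a GRing.unit) = ~~ (p %| a)%N.
Proof.
rewrite unitZpE ?(ltnW (odd_prime_expn_gt2 _)) //.
by rewrite coprime_pexpl // prime_coprime.
Qed.

(** Being a unit means being prime to p at both levels, so the representative of a is also a unit
    modulo p^s; its expression there reduces modulo p^m. *)
Lemma Zm_units (a : Zm) : a \is a GRing.unit ->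
  exists r, a = l%:~R ^+ r \/ a = - l%:~R ^+ r.
Proof.
rewrite -[a]natr_Zp Zm_unit => ap.
have ps_gt2 := odd_prime_expn_gt2 s_gt0.
have aU : ((a : nat)%:R : 'Z_(p ^ s)) \is a GRing.unit.
  by rewrite unitZpE ?(ltnW ps_gt2) // coprime_pexpl // prime_coprime.
have [r aE] := half_order_units ps_gt2 h_odd hE ord_l aU; exists r.
case: aE => aE; [left | right].
  by rewrite -rmorphXn; apply: (@Zm_reduce (a : nat)); rewrite rmorphXn.
rewrite -rmorphXn -rmorphN; apply: (@Zm_reduce (a : nat)).
by rewrite rmorphN rmorphXn.
Qed.

Lemma Zm_primitive_root : exists r, (g%:~R : Zm) = - l%:~R ^+ r.
Proof.
have [r gE] := primitive_root_opp; exists r.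
rewrite -rmorphXn -rmorphN; apply: Zm_reduce.
by rewrite rmorphN rmorphXn.
Qed.


Lemma Zm_unit2 : (2%:R : Zm) \is a GRing.unit.
Proof. by rewrite Zm_unit // dvdn_prime2 // neq_ltn odd_prime_gt2 ?orbT. Qed.

Lemma Zm_unit_pm1 (a : Zm) : a \is a GRing.unit -> a ^+ h = 1 \/ a ^+ h = -1.
Proof.
case/Zm_units => r [] ->; [left | right].
  by rewrite exprAC Zm_expr expr1n.
by rewrite exprN_odd // exprAC Zm_expr expr1n.
Qed.

Lemma Zm_nonunit (a : Zm) : (a \isn't a GRing.unit) = (p %| a)%N.
Proof. by rewrite -[a in LHS]natr_Zp Zm_unit // negbK. Qed.

Lemma Zm_nonunitD (a b : Zm) : a \isn't a GRing.unit ->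
  b \isn't a GRing.unit -> a + b \isn't a GRing.unit.
Proof.
rewrite !Zm_nonunit => pa pb.
by rewrite -[a]natr_Zp -[b]natr_Zp -natrD -Zm_nonunit Zm_unit // dvdn_add.
Qed.

Lemma coset_pos : cyclotomic_coset (p ^ m) l 1 = pos_set Zm h.
Proof.
apply/setP => a; apply/cyclotomic_cosetP/idP => [[r ->]|aH].
  by rewrite mul1r inE rmorphXn exprAC Zm_expr expr1n.
have [r [aE|aE]] := Zm_units (pos_unit h_odd aH).
  by exists r; rewrite mul1r rmorphXn.
case: (pos_neg_disjoint Zm_unit2 aH); rewrite aE inE exprN_odd //.
by rewrite exprAC Zm_expr expr1n.
Qed.

Lemma coset_neg : cyclotomic_coset (p ^ m) l g = neg_set Zm h.
Proof.
have [k gE] := Zm_primitive_root.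
apply/setP => a; apply/cyclotomic_cosetP/idP => [[r ->]|aN].
  rewrite inE intrM rmorphXn /= gE mulNr -exprD exprN_odd // exprAC.
  by rewrite Zm_expr expr1n.
have [r [aE|aE]] := Zm_units (neg_unit h_odd aN).
  case: (pos_neg_disjoint Zm_unit2 _ aN); rewrite aE inE.
  by rewrite exprAC Zm_expr expr1n.
(* With g = -l^k and a = -l^r, the exponent should be r - k; adding kh keeps it a natural number and
   changes nothing, as l^h = 1. *)
exists (r + k * h.-1)%N; rewrite intrM rmorphXn /= gE mulNr -exprD aE.
rewrite addnCA -mulnS prednK ?odd_gt0 // exprD mulnC exprM Zm_expr expr1n.
by rewrite mulr1.
Qed.

End Reduction.
End PrimePower.

(** * Coset sums in the cyclic ring and sums over multiples *)

Lemma qX_expn (l n : nat) : (0 < n)%N -> ('qX : cyclic_ring l n) ^+ n = 1.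
Proof.
move=> n_gt0; set P : {poly 'F_l} := 'X^n - 1.
have P0 : in_qpoly P P = 0.
  apply: val_inj; rewrite /= cyclic_ring_modulus //.
  by rewrite Pdiv.RingMonic.rmodpp ?monicXnsubC.
have -> : 'qX ^+ n = in_qpoly P ('X^n) by rewrite rmorphXn.
by rewrite -[X in in_qpoly P X](subrK 1) rmorphD /= P0 add0r in_qpoly1.
Qed.

(** Multiplication by d embeds Z/M in Z/(dM) and carries the coset of gamma onto that of d gamma; on
    exponents it replaces x by x^d. *)
Lemma coset_sum_scale (l d M : nat) (gamma : int) : (0 < d)%N -> (1 < M)%N ->
  coset_sum (d * M) l (d%:Z * gamma)
    = \sum_(a in cyclotomic_coset M l gamma)
         (('qX : cyclic_ring l (d * M)) ^+ d) ^+ (a : nat).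
Proof.
move=> d_gt0 M_gt1.
have n_gt1 : (1 < d * M)%N by apply: leq_trans M_gt1 _; apply: leq_pmull.
pose f (a : 'Z_M) : 'Z_(d * M) := (d * a)%:R.
have fE a : f a = (d * a)%N :> nat.
  rewrite val_Zp_nat // modn_small // ltn_pmul2l //.
  by rewrite -[X in (_ < X)%N](Zp_cast M_gt1).
have f_inj : injective f.
  move=> a b /(congr1 val); rewrite /= !fE => /eqP.
  by rewrite eqn_pmul2l // => /eqP/val_inj.
(* [f] uses the representative of a residue; any other integer z in the class does as well, since M
   dividing a - z gives dM dividing da - dz. *)
have fZ (z : int) : f z%:~R = (d%:Z * z)%:~R.
  set a : 'Z_M := z%:~R.
  have : (M %| (a : nat)%:Z - z)%Z.
    by rewrite -intr_Zp_eq0 // intrB -/a -pmulrn natr_Zp subrr.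
  move=> M_az; rewrite /f pmulrn PoszM; apply/eqP.
  by rewrite -subr_eq0 -intrB intr_Zp_eq0 // -mulrBr PoszM dvdz_mul.
rewrite /coset_sum.
have -> : cyclotomic_coset (d * M) l (d%:Z * gamma)
            = f @: cyclotomic_coset M l gamma.
  apply/setP => b.
  apply/cyclotomic_cosetP/imsetP => [[r ->]|[_ /cyclotomic_cosetP[r ->] ->]].
    exists (gamma * l%:Z ^+ r)%:~R; last by rewrite fZ mulrA.
    by apply/cyclotomic_cosetP; exists r.
  by exists r; rewrite fZ mulrA.
rewrite big_imset /=; last by move=> a b _ _; apply: f_inj.
by apply: eq_bigr => a _; rewrite fE; apply: exprM.
Qed.

(** The range is cut into n blocks of length k; only the first index of each block is a multiple of
    k. *)
Lemma sum_multiples (V : nmodType) (F : nat -> V) (k n : nat) : (0 < k)%N ->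
  \sum_(0 <= c < n * k | (k %| c)%N) F c = \sum_(0 <= c < n) F (c * k)%N.
Proof.
move=> k_gt0; rewrite big_mkcond big_nat_mul; apply: eq_bigr => i _.
rewrite big_ltn ?ltn_pmul2r // dvdn_mull // big_nat_cond big1 /= ?addr0 // => c.
rewrite mulSn addnC andbT => /andP[ic ci]; case: ifP => // /dvdnP[j cE].
move: ic ci; rewrite cE ltn_pmul2r // -mulSnr ltn_pmul2r //.
by rewrite ltnS ltnNge => /negbTE ->.
Qed.

Lemma sum_Zp (V : nmodType) (n : nat) (P : pred nat) (F : nat -> V) :
  (1 < n)%N ->
  \sum_(a : 'Z_n | P a) F a = \sum_(0 <= c < n | P c) F c.
Proof. by move=> n_gt1; rewrite -(big_mkord P F) Zp_cast. Qed.

(** * The elements chi as sums of powers of y_i = x^(p^i q^t) *)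

Section ResidueSums.

Variables (p s t q l h : nat) (g : int).
Hypotheses (p_prime : prime p) (p_odd : odd p) (s_gt0 : (0 < s)%N).
Hypotheses (q_gt0 : (0 < q)%N).
Hypotheses (h_odd : odd h) (hE : totient (p ^ s) = h.*2).
Hypotheses (ord_l : mult_order (p ^ s) l%:Z = h).
Hypothesis (ord_g : primitive_root_mod (p ^ s) g).

Local Notation A := (cyclic_ring l (p ^ s * q ^ t)).
Local Notation y i := (('qX : A) ^+ (p ^ i * q ^ t)).
Local Notation X k := (chi p q s t l k t).
Local Notation X' k := (chi_star p q s t l g k t).

Lemma coset_sum_res (i : nat) (gamma : int) : (i < s)%N ->
  coset_sum (p ^ s * q ^ t) l ((p ^ i * q ^ t)%N%:Z * gamma)
    = \sum_(a in cyclotomic_coset (p ^ (s - i)) l gamma) y i ^+ (a : nat).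
Proof.
move=> i_s; have nE : (p ^ s * q ^ t = p ^ i * q ^ t * p ^ (s - i))%N.
  by rewrite mulnAC -expnD subnKC // ltnW.
have d_gt0 : (0 < p ^ i * q ^ t)%N.
  by rewrite muln_gt0 !expn_gt0 prime_gt0 ?q_gt0.
have M_gt1 : (1 < p ^ (s - i))%N by rewrite ltnW ?odd_prime_expn_gt2 ?subn_gt0.
by rewrite nE; apply: coset_sum_scale.
Qed.

Lemma chi_res (i : nat) : (i < s)%N ->
  X i = \sum_(a in pos_set 'Z_(p ^ (s - i)) h) y i ^+ (a : nat).
Proof.
move=> i_s; rewrite /chi -[(p ^ i * q ^ t)%N%:Z]mulr1 coset_sum_res //.
by rewrite (coset_pos p_prime p_odd s_gt0 h_odd hE ord_l) ?subn_gt0 ?leq_subr.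
Qed.

Lemma chi_star_res (i : nat) : (i < s)%N ->
  X' i = \sum_(a in neg_set 'Z_(p ^ (s - i)) h) y i ^+ (a : nat).
Proof.
move=> i_s; rewrite /chi_star coset_sum_res //.
rewrite (coset_neg p_prime p_odd s_gt0 h_odd hE ord_l ord_g) ?subn_gt0 //.
exact: leq_subr.
Qed.

Lemma y_expn (i : nat) : (i <= s)%N -> y i ^+ (p ^ (s - i)) = 1.
Proof.
move=> i_s; rewrite -exprM mulnAC -expnD subnKC // qX_expn //.
by rewrite muln_gt0 !expn_gt0 prime_gt0 ?q_gt0.
Qed.

(** Nonunits are the multiples of p, and y_i^p = y_(i+1). *)
Lemma sum_nonunit (i : nat) : (i < s)%N ->
  \sum_(a in nonunit_set 'Z_(p ^ (s - i))) y i ^+ (a : nat)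
    = \sum_(0 <= c < p ^ (s - i.+1)) y i.+1 ^+ c.
Proof.
move=> i_s; have m_gt0 : (0 < s - i)%N by rewrite subn_gt0.
have M_gt1 : (1 < p ^ (s - i))%N by rewrite ltnW ?odd_prime_expn_gt2.
transitivity (\sum_(0 <= c < p ^ (s - i) | (p %| c)%N) y i ^+ c).
  rewrite -sum_Zp //; apply: eq_bigl => a.
  by rewrite inE (Zm_nonunit p_prime p_odd).
rewrite -(subnSK i_s) expnSr sum_multiples ?prime_gt0 //; apply: eq_bigr => c _.
rewrite -!exprM; congr (_ ^+ _).
by rewrite [(c * p)%N]mulnC mulnA [(_ * p)%N]mulnAC expnSr.
Qed.

(** Induction on s - i: units contribute the terms of index i, and the nonunits give the same sum
    for i + 1. At i = s only the term 1 remains. *)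
Lemma full_sum (i : nat) : (i <= s)%N ->
  \sum_(0 <= c < p ^ (s - i)) y i ^+ c = \sum_(i <= k < s) (X k + X' k) + 1.
Proof.
move=> i_s; have [d] : exists d, (s - i)%N = d by exists (s - i)%N.
elim: d i i_s => [|d IHd] i i_s dE.
  have -> : i = s by apply/eqP; rewrite eqn_leq i_s -subn_eq0 dE.
  by rewrite subnn expn0 big_nat1 expr0 big_geq ?add0r.
have i_lt : (i < s)%N by rewrite -subn_gt0 dE.
have M_gt1 : (1 < p ^ (s - i))%N by rewrite ltnW ?odd_prime_expn_gt2 ?subn_gt0.
have [m_gt0 m_s] : (0 < s - i)%N /\ (s - i <= s)%N by rewrite subn_gt0 leq_subr.
rewrite -sum_Zp // (sum_split h_odd); first last.
- exact: (Zm_unit_pm1 p_prime p_odd s_gt0 h_odd hE ord_l).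
- exact: (Zm_unit2 p_prime p_odd).
rewrite -chi_res // -chi_star_res // sum_nonunit // IHd ?subnS ?dE //.
by rewrite [in RHS]big_ltn // !addrA.
Qed.

Lemma sum_nonunit_chi (i : nat) : (i < s)%N ->
  \sum_(a in nonunit_set 'Z_(p ^ (s - i))) y i ^+ (a : nat)
    = \sum_(i.+1 <= k < s) (X k + X' k) + 1.
Proof. by move=> i_s; rewrite sum_nonunit // full_sum. Qed.

(** The sum a + b is reduced modulo p^(s-i), which is harmless because that power of y_i is 1. *)
Lemma y_exprD (i : nat) (a b : 'Z_(p ^ (s - i))) : (i < s)%N ->
  y i ^+ ((a + b)%R : nat) = y i ^+ a * y i ^+ b.
Proof.
move=> i_s.
have M_gt1 : (1 < p ^ (s - i))%N.
  by rewrite ltnW ?odd_prime_expn_gt2 ?subn_gt0.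
have yM : y i ^+ (Zp_trunc (p ^ (s - i))).+2 = 1.
  by rewrite Zp_cast // y_expn // ltnW.
by rewrite -exprD; apply: expr_mod yM.
Qed.

Lemma chi_products (i : nat) : (i < s)%N ->
  let al := repr_count (pos_set 'Z_(p ^ (s - i)) h) (pos_set _ h) 1 in
  let be := repr_count (pos_set 'Z_(p ^ (s - i)) h) (pos_set _ h) (-1) in
  [/\ X i ^+ 2 = X i *+ al + X' i *+ be, X' i ^+ 2 = X' i *+ al + X i *+ be
    & X i * X' i
      = (X i + X' i) *+ al
        + (\sum_(i.+1 <= k < s) (X k + X' k) + 1)
          *+ #|pos_set 'Z_(p ^ (s - i)) h| ].
Proof.
move=> i_s al be; have [m_gt0 m_s] : (0 < s - i)%N /\ (s - i <= s)%N.
  by rewrite subn_gt0 leq_subr.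
have U2 := Zm_unit2 p_prime p_odd m_gt0.
have U1 := Zm_unit_pm1 p_prime p_odd s_gt0 h_odd hE ord_l m_gt0 m_s.
have UD := Zm_nonunitD p_prime p_odd m_gt0.
pose e (a : 'Z_(p ^ (s - i))) := y i ^+ (a : nat).
have eD (a b : 'Z_(p ^ (s - i))) : e (a + b) = e a * e b := y_exprD a b i_s.
rewrite -sum_nonunit_chi // chi_res // chi_star_res //; split.
- exact: (sum_posX2 h_odd U2 U1 eD).
- exact: (sum_negX2 h_odd U2 U1 eD).
- exact: (sum_pos_neg h_odd U2 U1 UD eD).
Qed.

End ResidueSums.

(** * Evaluation of the coefficients *)

Lemma card_nonunit_set (p m : nat) : prime p -> odd p -> (0 < m)%N ->
  #|nonunit_set 'Z_(p ^ m)| = (p ^ m.-1)%N.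
Proof.
move=> p_prime p_odd m_gt0.
have M_gt1 : (1 < p ^ m)%N by rewrite ltnW ?odd_prime_expn_gt2.
rewrite -sum1_card -[RHS]muln1 -[(p ^ m.-1)%N in RHS]subn0 -sum_nat_const_nat.
rewrite -(sum_multiples (fun=> 1%N)  _ (prime_gt0 p_prime)) -expnSr prednK //.
rewrite -sum_Zp //; apply: eq_bigl => a.
by rewrite inE (Zm_nonunit p_prime p_odd).
Qed.

Theorem theorem4p5 (s t p q l i : nat) (g : int)
  (s_ge1 : (1 <= s)%N) (t_ge1 : (1 <= t)%N)
  (p_prime : prime p) (q_prime : prime q) (l_prime : prime l)
  (p_neq_q : p <> q) (p_neq_l : p <> l) (q_neq_l : q <> l)
  (p_odd : odd p) (q_odd : odd q)
  (p_mod4 : p = 3 %[mod 4])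
  (ord_p : mult_order (p ^ s) l%:Z = (totient (p ^ s) %/ 2)%N)
  (ord_q : mult_order (q ^ t) l%:Z = totient (q ^ t))
  (gcd_totient : gcdn (totient (p ^ s)) (totient (q ^ t)) = 2%N)
  (g_p : primitive_root_mod (p ^ s) g)
  (g_q : primitive_root_mod (q ^ t) g)
  (i_le : (i <= s - 1)%N) :
  let X (k : nat) := chi p q s t l k t in
  let X' (k : nat) := chi_star p q s t l g k t in
  let a : 'F_l := ((p - 3) %/ 4 * p ^ (s - i - 1))%N%:R in
  let b : 'F_l := ((p + 1) %/ 4 * p ^ (s - i - 1))%N%:R in
  let c : 'F_l := (totient (p ^ (s - i)) %/ 2)%N%:R in
  [/\ X i ^+ 2 = a *: X i + b *: X' i,
      X' i ^+ 2 = a *: X' i + b *: X i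
    & X i * X' i
      = a *: (X i + X' i) + c *: (\sum_(i.+1 <= k < s) (X k + X' k) + 1)].
Proof.
move=> X X' a b c.
have i_s : (i < s)%N by rewrite -ltnS -subSn // subn1 in i_le.
have [m_gt0 m_s] : (0 < s - i)%N /\ (s - i <= s)%N by rewrite subn_gt0 leq_subr.
(* Thus (p - 3)/4 = k, (p + 1)/4 = k + 1 and (p - 1)/2 = 2k + 1, which is odd; all these divisions
   are exact. *)
have [k pE] : exists k, p = (4 * k + 3)%N.
  by exists (p %/ 4)%N; rewrite {1}(divn_eq p 4) p_mod4 mulnC.
have totE m : (0 < m)%N -> totient (p ^ m) = ((2 * k + 1) * p ^ m.-1).*2.
  move=> m0; rewrite totient_pfactor // doubleMl; congr (_ * _)%N.
  by rewrite pE addn3 /= -addn2 -muln2 mulnDl mulnAC.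
set h := ((2 * k + 1) * p ^ s.-1)%N.
have h_odd : odd h by rewrite oddM oddX p_odd orbT oddD oddM.
have hE : totient (p ^ s) = h.*2 by apply: totE.
have ord_l : mult_order (p ^ s) l%:Z = h by rewrite ord_p hE divn2 doubleK.
have U2 := Zm_unit2 p_prime p_odd m_gt0.
have U1 := Zm_unit_pm1 p_prime p_odd s_ge1 h_odd hE ord_l m_gt0 m_s.
have UD := Zm_nonunitD p_prime p_odd m_gt0.
have M_gt1 : (1 < p ^ (s - i))%N by rewrite ltnW ?odd_prime_expn_gt2.
have := card_ring_split h_odd U2 U1; have [] := card_pos_split h_odd U2 U1 UD.
have q_gt0 := prime_gt0 q_prime.
have [] := chi_products t p_prime p_odd s_ge1 q_gt0 h_odd hE ord_l g_p i_s.
set H := pos_set _ h; set al := repr_count _ _ 1; set be := repr_count _ _ (-1).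
rewrite -/(X i) -/(X' i) => X2 X'2 XX' cardH1 cardH2.
rewrite card_nonunit_set // in cardH1 *; rewrite card_ord Zp_cast // => cardR.
set P := (p ^ (s - i).-1)%N in cardH1 cardR.
(* The partition of the ring gives pP = 2|H| + P, with p = 2(2k + 1) + 1. *)
have cardH : #|H| = ((2 * k + 1) * P)%N.
  have pM n : (p * n = ((2 * k + 1) * n).*2 + n)%N.
    by rewrite pE doubleMl -mulSnr doubleD -mul2n mulnA -addnS.
  by apply/double_inj/(@addIn P); rewrite -cardR -pM /P -expnS prednK.
(* From 2 alpha + P = |H| = 2kP + P; then beta is |H| - alpha. *)
have alE : al = (k * P)%N.
  apply/double_inj/(@addIn P); rewrite -cardH1 cardH mulnDl mul1n.
  by rewrite -mulnA mul2n.
have beE : be = (k.+1 * P)%N.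
  apply/(@addnI al); rewrite -cardH2 cardH alE -mulnDl.
  by rewrite addn1 mul2n -addnn addnS.
have -> : a = al%:R.
  by rewrite alE /a subn1 {1}pE addnK mulKn.
have -> : b = be%:R.
  by rewrite beE /b subn1 {1}pE -addnA -mulnSr mulKn.
have -> : c = #|H|%:R.
  by rewrite cardH /c totE // divn2 doubleK.
by rewrite !scaler_nat.
Qed.
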